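(* Let $\Phi$ be a frame for $\mathcal H$ with lower frame bound $m_\Phi$ and let the Bessel sequence $\Psi$ be a $\mu$-perturbation of $\Phi$ with $\mu<\sqrt{m_\Phi}$. Then $\Psi$ is a frame for $\mathcal H$ with lower frame bound $(\sqrt{m_\Phi}-\mu)^2$. Moreover, if $\mathcal A\in B(\mathcal H)$ satisfies $\|Id_{\mathcal H}-\mathcal A\|_{\rm op}<1$, then for the canonical dual $\widetilde\Phi(0)$ of $\Phi$ and the canonical approximate dual $\Psi^{ad}_0(\mathcal A)$ of $\Psi$ we have $$\big\|\widetilde\Phi(0)-\Psi^{ad}_0(\mathcal A)\big\|_{\mathfrak{Fr}}\le\frac{2\mu\|\mathcal A\|_{\rm op}+\varepsilon\sqrt{m_\Phi}}{\sqrt{m_\Phi}(\sqrt{m_\Phi}-\mu)},$$ where $\varepsilon$ is the approximation rate of $\big(\Psi,\Psi^{ad}_0(\mathcal A)\big)$.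
   Context: $\mathcal H$ is a separable Hilbert space, $\ell^2=\ell^2(\mathbb N)$. A sequence $\Phi=(\varphi_n)_{n\in\mathbb N}$ in $\mathcal H$ is a frame with (lower, upper) bounds $m_\Phi,M_\Phi>0$ if $m_\Phi\|f\|^2\le\sum_n|\langle f,\varphi_n\rangle|^2\le M_\Phi\|f\|^2$ for all $f\in\mathcal H$; it is a Bessel sequence if the right inequality holds. For a Bessel sequence $\Phi$: the analysis operator is $U_\Phi:\mathcal H\to\ell^2$, $U_\Phi f=(\langle f,\varphi_n\rangle)_n$; the synthesis operator is $T_\Phi=U_\Phi^*$; the frame operator is $S_\Phi=T_\Phi U_\Phi$; and $\|\Phi\|_{\mathfrak{Fr}}:=\|T_\Phi\|_{\rm op}$. Differences of sequences are componentwise. A Bessel sequence $\Psi$ is a $\mu$-perturbation of $\Phi$ if $\|\Phi-\Psi\|_{\mathfrak{Fr}}=\|T_\Phi-T_\Psi\|_{\rm op}\le\mu$. For a frame $\Phi$, the canonical dual is $\widetilde\Phi(0)=(S_\Phi^{-1}\varphi_n)_n$. For a frame $\Psi=(\psi_n)_n$ and $\mathcal A\in B(\mathcal H)$ with $\|Id_{\mathcal H}-\mathcal A\|_{\rm op}<1$, the canonical approximate dual $\Psi^{ad}_0(\mathcal A)$ is the sequence $\big(\mathcal A^*S_\Psi^{-1}\psi_n\big)_n$; it satisfies $T_\Psi U_{\Psi^{ad}_0(\mathcal A)}=\mathcal A$. The approximation rate of a pair $(\Psi,\Psi^{ad})$ with $\|Id_{\mathcal H}-T_\Psi U_{\Psi^{ad}}\|_{\rm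 op}<1$ is a number $\varepsilon\in[0,1)$ with $\|Id_{\mathcal H}-T_\Psi U_{\Psi^{ad}}\|_{\rm op}\le\varepsilon$. *)

(* Defs.v *)
From HB Require Import structures.
From mathcomp Require Import all_boot all_order all_algebra.
From mathcomp Require Import complex ring.
From mathcomp Require Import all_classical all_reals all_analysis.

Set Implicit Arguments.
Unset Strict Implicit.
Unset Printing Implicit Defensive.

Import Order.TTheory GRing.Theory Num.Theory.
Import numFieldNormedType.Exports.

Local Open Scope classical_set_scope.
Local Open Scope ring_scope.

Variant scalar_kind := RealScalars | ComplexScalars.

Definition scalars (R : realType) (k : scalar_kind) : numFieldType :=
  match k with RealScalars => R | ComplexScalars => R[i] end.

(* Complex conjugation, the identity on real scalars. *)
Definition sconj (R : realType) (k : scalar_kind) :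
    scalars R k -> scalars R k :=
  match k with RealScalars => id | ComplexScalars => @conjc R end.

Definition sre (R : realType) (k : scalar_kind) : scalars R k -> R :=
  match k with RealScalars => id | ComplexScalars => @complex.Re R end.

(* The embedding of the reals into the scalars. *)
Definition of_real (R : realType) (k : scalar_kind) : R -> scalars R k :=
  match k with RealScalars => id | ComplexScalars => real_complex R end.

Section ScalarTheory.
Variables (R : realType) (k : scalar_kind).
Local Notation K := (scalars R k).

Fact sconj_is_additive : zmod_morphism (@sconj R k).
Proof. by rewrite /sconj; case: k => //= x y; rewrite rmorphB. Qed.

Fact sconj_is_multiplicative : monoid_morphism (@sconj R k).
Proof.
by rewrite /sconj; case: k => //=; split=> [|x y]; rewrite ?rmorph1 ?rmorphM.
Qed.

HB.instance Definition _ :=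
  GRing.isZmodMorphism.Build K K (@sconj R k) sconj_is_additive.
HB.instance Definition _ :=
  GRing.isMonoidMorphism.Build K K (@sconj R k) sconj_is_multiplicative.

Lemma sconjK : involutive (@sconj R k).
Proof. by rewrite /sconj; case: k => //= -[a b] /=; rewrite opprK. Qed.

Lemma norm_sconj (x : K) : `|sconj x| = `|x|.
Proof. by rewrite /sconj; case: k x => //= x; rewrite normcJ. Qed.

Lemma mul_sconj (x : K) : x * sconj x = `|x| ^+ 2.
Proof.
rewrite /sconj; case: k x => /= x; last by rewrite sqr_normc.
by rewrite -expr2 real_normK// num_real.
Qed.

Fact sre_is_additive : zmod_morphism (@sre R k).
Proof. by rewrite /sre; case: k => //= -[a b] [c d]. Qed.

HB.instance Definition _ :=
  GRing.isZmodMorphism.Build K R (@sre R k) sre_is_additive.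

Fact of_real_is_additive : zmod_morphism (@of_real R k).
Proof. by rewrite /of_real; case: k => //= a b; rewrite rmorphB. Qed.

Fact of_real_is_multiplicative : monoid_morphism (@of_real R k).
Proof.
by rewrite /of_real; case: k => //=; split=> [|a b]; rewrite ?rmorph1 ?rmorphM.
Qed.

HB.instance Definition _ :=
  GRing.isZmodMorphism.Build R K (@of_real R k) of_real_is_additive.
HB.instance Definition _ :=
  GRing.isMonoidMorphism.Build R K (@of_real R k) of_real_is_multiplicative.

Lemma of_realK (x : R) : sre (of_real k x) = x.
Proof. by rewrite /sre /of_real; case: k. Qed.

Lemma sreK (x : K) : 0 <= x -> of_real k (sre x) = x.
Proof.
rewrite /sre /of_real; case: k x => // -[a b] /=.
by rewrite lecE /= => /andP[/eqP -> _].
Qed.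

Lemma ler_of_real (x y : R) : (of_real k x <= of_real k y) = (x <= y).
Proof. by rewrite /of_real; case: k => //; rewrite lecR. Qed.

Lemma ltr_of_real (x y : R) : (of_real k x < of_real k y) = (x < y).
Proof. by rewrite /of_real; case: k => //; rewrite ltcR. Qed.

Lemma norm_of_real (x : R) : `|of_real k x| = of_real k `|x|.
Proof.
rewrite /of_real; case: k => //=.
by rewrite normc_def /= expr0n addr0 sqrtr_sqr.
Qed.

End ScalarTheory.

(* The inner product is linear in its first argument and conjugate-linear in
   its second one. *)
HB.mixin Record isInnerProductSpace (R : realType) (k : scalar_kind) V
    & NormedModule (scalars R k) V := {
  inner : {dot V for @sconj R k} ;
  innerE : forall x : V, inner x x = `|x| ^+ 2
}.

#[short(type="innerProductSpaceType")]
HB.structure Definition InnerProductSpace (R : realType) (k : scalar_kind) :=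
  {V of NormedModule (scalars R k) V & isInnerProductSpace R k V}.

#[short(type="hilbertType")]
HB.structure Definition Hilbert (R : realType) (k : scalar_kind) :=
  {V of CompleteNormedModule (scalars R k) V & isInnerProductSpace R k V}.

Section RealNorm.
Variables (R : realType) (k : scalar_kind) (V : normedModType (scalars R k)).

(* In a [normedModType K] the norm is K-valued; this is its value as a real
   number. *)
Definition rnorm (x : V) : R := sre `|x|.

Lemma rnormK (x : V) : of_real k (rnorm x) = `|x|.
Proof. by rewrite sreK. Qed.

Lemma rnorm_ge0 (x : V) : 0 <= rnorm x.
Proof. by rewrite -(ler_of_real k) rnormK rmorph0. Qed.

Lemma rnormD (x y : V) : rnorm (x + y) <= rnorm x + rnorm y.
Proof. by rewrite -(ler_of_real k) rmorphD/= !rnormK ler_normD. Qed.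

End RealNorm.

Lemma rnormZ (R : realType) (k : scalar_kind) (V : normedModType (scalars R k))
  (a : scalars R k) (x : V) : rnorm (a *: x) = rnorm a * rnorm x.
Proof.
by apply: (can_inj (@of_realK R k)); rewrite rmorphM/= !rnormK normrZ.
Qed.

Lemma rnorm_sconj (R : realType) (k : scalar_kind) (a : scalars R k) :
  rnorm (sconj a) = rnorm a.
Proof. by rewrite /rnorm norm_sconj. Qed.

Lemma scalars_normed_cvg (R : realType) (k : scalar_kind)
    (u : nat -> scalars R k) :
  cvgn (series (fun n => rnorm (u n))) -> cvgn (series u).
Proof.
move=> hu.
suff [l hl] : exists l : scalars R k, forall e : R, 0 < e ->
    \forall n \near \oo, `|l - series u n| < of_real k e.
  apply/cvg_ex; exists l; apply/cvgrPdist_lt => e e0.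
  have e0' : 0 < sre e by rewrite -(ltr_of_real k) sreK ?rmorph0// ltW.
  by apply: filterS (hl _ e0') => n; rewrite sreK// ltW.
case: k u hu => u hu.
  have /cvg_ex[/= l hl] : cvgn (series u) by exact: normed_cvg.
  by exists l => e e0; move/cvgrPdist_lt : hl => /(_ _ e0).
have rnormC n : ((rnorm (u n))%:C)%C = `|u n| := rnormK (u n).
have re_le n : 0 <= `|complex.Re (u n)| <= rnorm (u n).
  rewrite normr_ge0 /= -lecR rnormC.
  exact: normc_ge_Re.
have im_le n : 0 <= `|complex.Im (u n)| <= rnorm (u n).
  rewrite normr_ge0 /= -lecR rnormC (_ : complex.Im (u n) = - complex.Re (u n * 'i%C)).
    rewrite normrN (le_trans (normc_ge_Re _))// normrM [X in _ * X](_ : _ = 1) ?mulr1//.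
    by rewrite normc_def/= expr0n expr1n add0r sqrtr1.
  by rewrite ReiNIm opprK.
have /cvg_ex[/= a ha] : cvgn (series (fun n => complex.Re (u n))).
  apply: normed_cvg; apply: series_le_cvg hu => n.
  - exact: normr_ge0.
  - exact: rnorm_ge0.
  - by case/andP: (re_le n).
have /cvg_ex[/= b hb] : cvgn (series (fun n => complex.Im (u n))).
  apply: normed_cvg; apply: series_le_cvg hu => n.
  - exact: normr_ge0.
  - exact: rnorm_ge0.
  - by case/andP: (im_le n).
exists (a +i* b)%C => e e0.
have e20 : 0 < e / 2 by rewrite divr_gt0.
move/cvgrPdist_lt : ha => /(_ _ e20) ha.
move/cvgrPdist_lt : hb => /(_ _ e20) hb.
apply: filterS2 ha hb => n han hbn.
have -> : series u n =
    (series (fun i => complex.Re (u i)) n +i* series (fun i => complex.Im (u i)) n)%C.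
  rewrite /series/=; elim: n {han hbn} => [|m IH]; first by rewrite !big_geq.
  by rewrite !big_nat_recr//= IH; case: (u m).
set x := series _ n; set y := series _ n.
have -> : (a +i* b - (x +i* y))%C = ((a - x)%:C + 'i%C * (b - y)%:C)%C :> R[i].
  by apply/eqP; rewrite eq_complex/=; apply/andP; split; apply/eqP; ring.
apply: le_lt_trans (ler_normD _ _) _.
rewrite normrM [`|'i%C|](_ : _ = 1) ?mul1r; last first.
  by rewrite normc_def/= expr0n expr1n add0r sqrtr1.
rewrite !normc_def/= expr0n/= !addr0 !sqrtr_sqr -rmorphD/= ltcR.
rewrite [ltRHS]splitr; exact: ltrD.
Qed.

Section SequenceSpace.
Variables (R : realType) (k : scalar_kind).
Local Notation K := (scalars R k).
Implicit Types c d : nat -> K.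

Definition sqsum c : \bar R := (\sum_(n <oo) ((rnorm (c n)) ^+ 2)%:E)%E.

Definition square_summable : {pred nat -> K} :=
  [pred c | `[< (sqsum c < +oo)%E >]].

Lemma square_summableP c : (sqsum c < +oo)%E <-> c \in square_summable.
Proof. by split=> [?|/asboolP //]; apply/asboolP. Qed.

Lemma sqsum_ge0 c : (0 <= sqsum c)%E.
Proof. by apply: nneseries_ge0 => n _ _; rewrite lee_fin sqr_ge0. Qed.

Lemma sqsum_fineK c : (sqsum c < +oo)%E -> sqsum c = (fine (sqsum c))%:E.
Proof. by move=> h; rewrite fineK// ge0_fin_numE// sqsum_ge0. Qed.

Lemma sqsum_leP c (M : R) :
  (sqsum c <= M%:E)%E <-> forall N, \sum_(0 <= n < N) rnorm (c n) ^+ 2 <= M.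
Proof.
split=> [h N|h].
  rewrite -lee_fin -sumEFin; apply: le_trans h.
  by apply: nneseries_lim_ge => n _ _; rewrite lee_fin sqr_ge0.
apply: lime_le.
  by apply: is_cvg_nneseries => n _ _; rewrite lee_fin sqr_ge0.
by apply: nearW => N; rewrite sumEFin lee_fin.
Qed.

Definition l2norm c : R := Num.sqrt (fine (sqsum c)).

Lemma l2norm_ge0 c : 0 <= l2norm c. Proof. exact: sqrtr_ge0. Qed.

Lemma sqr_l2norm c : l2norm c ^+ 2 = fine (sqsum c).
Proof. by rewrite sqr_sqrtr// fine_ge0// sqsum_ge0. Qed.

Lemma sum_le_l2norm c : (sqsum c < +oo)%E ->
  forall N, \sum_(0 <= n < N) rnorm (c n) ^+ 2 <= l2norm c ^+ 2.
Proof.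
by move=> h; apply/sqsum_leP; rewrite sqr_l2norm -sqsum_fineK.
Qed.

Lemma rnorm_le_l2norm c n : (sqsum c < +oo)%E -> rnorm (c n) <= l2norm c.
Proof.
move=> h; rewrite -(@ler_pXn2r _ 2)// ?nnegrE ?rnorm_ge0 ?l2norm_ge0//.
apply: le_trans (sum_le_l2norm h n.+1); rewrite big_nat_recr//= lerDr.
by apply: sumr_ge0 => i _; rewrite sqr_ge0.
Qed.

Lemma l2norm_le c (M : R) : 0 <= M ->
  (forall N, \sum_(0 <= n < N) rnorm (c n) ^+ 2 <= M ^+ 2) ->
  (sqsum c < +oo)%E /\ l2norm c <= M.
Proof.
move=> M0 /sqsum_leP h; have h' := le_lt_trans h (ltry _); split=> //.
rewrite -(@ler_pXn2r _ 2)// ?nnegrE ?l2norm_ge0// sqr_l2norm.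
by rewrite -lee_fin -sqsum_fineK.
Qed.

Lemma sum_mul_le_l2norm c d N : (sqsum c < +oo)%E -> (sqsum d < +oo)%E ->
  \sum_(0 <= n < N) rnorm (c n) * rnorm (d n) <= l2norm c * l2norm d.
Proof.
move=> hc hd.
have [c0|cN0] := eqVneq (l2norm c) 0.
  rewrite c0 mul0r big1// => n _.
  have := rnorm_le_l2norm n hc; rewrite c0 => h.
  suff -> : rnorm (c n) = 0 by rewrite mul0r.
  by apply/le_anti; rewrite h rnorm_ge0.
have [d0|dN0] := eqVneq (l2norm d) 0.
  rewrite d0 mulr0 big1// => n _.
  have := rnorm_le_l2norm n hd; rewrite d0 => h.
  suff -> : rnorm (d n) = 0 by rewrite mulr0.
  by apply/le_anti; rewrite h rnorm_ge0.
have s0 : 0 < l2norm c by rewrite lt_neqAle eq_sym cN0 l2norm_ge0.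
have t0 : 0 < l2norm d by rewrite lt_neqAle eq_sym dN0 l2norm_ge0.
have hC := sum_le_l2norm hc N; have hD := sum_le_l2norm hd N.
move: s0 t0 hC hD {cN0 dN0}.
set s := l2norm c; set t := l2norm d => s0 t0 hC hD.
rewrite -(@ler_pM2l _ (2 * s * t)); last by rewrite !mulr_gt0.
apply: (@le_trans _ _ (t ^+ 2 * \sum_(0 <= n < N) rnorm (c n) ^+ 2
   + s ^+ 2 * \sum_(0 <= n < N) rnorm (d n) ^+ 2)).
  rewrite !mulr_sumr -big_split/=; apply: ler_sum => n _.
  rewrite -subr_ge0.
  have -> : t ^+ 2 * rnorm (c n) ^+ 2 + s ^+ 2 * rnorm (d n) ^+ 2
   - 2 * s * t * (rnorm (c n) * rnorm (d n))
   = (t * rnorm (c n) - s * rnorm (d n)) ^+ 2.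
    by ring.
  exact: sqr_ge0.
have -> : 2 * s * t * (s * t) = t ^+ 2 * s ^+ 2 + s ^+ 2 * t ^+ 2 by ring.
by apply: lerD; rewrite ler_pM2l// exprn_gt0.
Qed.

Lemma l2normD c d : (sqsum c < +oo)%E -> (sqsum d < +oo)%E ->
  (sqsum (c + d)%R < +oo)%E /\ l2norm (c + d)%R <= l2norm c + l2norm d.
Proof.
move=> hc hd; apply: l2norm_le => [|N]; first by rewrite addr_ge0 ?l2norm_ge0.
apply: (@le_trans _ _
  (\sum_(0 <= n < N) (rnorm (c n) + rnorm (d n)) ^+ 2)).
  apply: ler_sum => n _.
  by rewrite ler_pXn2r// ?nnegrE ?addr_ge0 ?rnorm_ge0// rnormD.
under eq_bigr do rewrite sqrrD.
rewrite 2!big_split/= sqrrD; apply: lerD; last exact: sum_le_l2norm.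
apply: lerD; first exact: sum_le_l2norm.
by rewrite sumrMnl lerMn2r/= sum_mul_le_l2norm.
Qed.

Lemma l2normZ (a : K) c : (sqsum c < +oo)%E ->
  (sqsum (a *: c)%R < +oo)%E /\ l2norm (a *: c) = rnorm a * l2norm c.
Proof.
move=> hc; rewrite /l2norm.
have -> : sqsum (a *: c) = ((rnorm a ^+ 2)%:E * sqsum c)%E.
  rewrite -nneseriesZl; last by move=> n _; rewrite lee_fin sqr_ge0.
  by apply: eq_eseriesr => n _; rewrite -EFinM -exprMn -rnormZ.
rewrite (sqsum_fineK hc) -EFinM/= sqrtrM ?sqr_ge0//; split; first exact: ltry.
by rewrite sqrtr_sqr ger0_norm ?rnorm_ge0.
Qed.

Lemma square_summable_submod : submod_closed square_summable.
Proof.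
split.
  apply/square_summableP; suff -> : sqsum 0 = 0%E by [].
  rewrite /sqsum eseries0// => n _ _.
  by rewrite /rnorm normr0 raddf0 expr0n.
move=> a c d /square_summableP hc /square_summableP hd; apply/square_summableP.
by have [+ _] := l2normZ a hc => /l2normD /(_ hd) [].
Qed.

HB.instance Definition _ :=
  GRing.isSubmodClosed.Build K (nat -> K) square_summable square_summable_submod.

Record l2 := L2 { l2val :> nat -> K ; l2valP : l2val \in square_summable }.

HB.instance Definition _ := [isSub for l2val].
HB.instance Definition _ := [Choice of l2 by <:].
HB.instance Definition _ := [SubChoice_isSubLmodule of l2 by <:].

Lemma l2_lty (c : l2) : (sqsum c < +oo)%E.
Proof. exact/square_summableP/l2valP. Qed.

Fact l2_normD (c d : l2) :
  of_real k (l2norm (c + d : l2)) <= of_real k (l2norm c) + of_real k (l2norm d).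
Proof. by rewrite -rmorphD/= ler_of_real (l2normD (l2_lty c) (l2_lty d)).2. Qed.

Fact l2_normZ (a : K) (c : l2) :
  of_real k (l2norm (a *: c : l2)) = `|a| * of_real k (l2norm c).
Proof. by rewrite (l2normZ a (l2_lty c)).2 rmorphM/= rnormK. Qed.

Fact l2_norm_eq0 (c : l2) : of_real k (l2norm c) = 0 -> c = 0.
Proof.
move=> /(congr1 (@sre R k)); rewrite of_realK raddf0 => c0.
apply/val_inj/funext => n; apply/eqP.
rewrite -[_ == _]normr_eq0 -rnormK; apply/eqP.
suff -> : rnorm (c n) = 0 by rewrite rmorph0.
by apply/le_anti; rewrite rnorm_ge0 -{1}c0 rnorm_le_l2norm// l2_lty.
Qed.

HB.instance Definition _ :=
  Lmodule_isNormed.Build K l2 l2_normD l2_normZ l2_norm_eq0.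

Lemma l2_normE (c : l2) : `|c| = of_real k (l2norm c). Proof. by []. Qed.

Lemma cvg_of_real (u : R ^nat) (x : R) :
  u @ \oo --> x -> (fun n => of_real k (u n)) @ \oo --> of_real k x.
Proof.
move=> ux; apply/cvgrPdist_lt => e e0.
have e0' : 0 < sre e by rewrite -(ltr_of_real k) sreK ?rmorph0// ltW.
move/cvgrPdist_lt : ux => /(_ _ e0'); apply: filterS => n.
by rewrite -rmorphB/= norm_of_real -(ltr_of_real k) sreK// ltW.
Qed.

Lemma cvg_sconj (u : K ^nat) (x : K) :
  u @ \oo --> x -> (fun n => sconj (u n)) @ \oo --> sconj x.
Proof.
move=> ux; apply/cvgrPdist_lt => e e0.
move/cvgrPdist_lt : ux => /(_ _ e0); apply: filterS => n.
by rewrite -rmorphB/= norm_sconj.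
Qed.


Definition l2inner (c d : l2) : K := limn (series (fun n => c n * sconj (d n))).

Lemma l2inner_cvg (c d : l2) :
  series (fun n => c n * sconj (d n)) @ \oo --> l2inner c d.
Proof.
apply/scalars_normed_cvg/nnseries_is_cvg => [n|]; first exact: rnorm_ge0.
apply: le_lt_trans (ltry (l2norm c * l2norm d)).
apply: lime_le.
  by apply: is_cvg_nneseries => n _ _; rewrite lee_fin rnorm_ge0.
apply: nearW => N; rewrite sumEFin lee_fin.
under eq_bigr => n _ do rewrite -[X in rnorm X]/(c n *: sconj (d n)) rnormZ rnorm_sconj.
by apply: sum_mul_le_l2norm; exact: l2_lty.
Qed.

Fact l2inner_Dl (c c' d : l2) :
  l2inner (c + c') d = l2inner c d + l2inner c' d.
Proof.
apply: etrans (cvg_lim _ (cvgD (@l2inner_cvg c d) (@l2inner_cvg c' d))); last exact: norm_hausdorff.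
congr (limn _); apply/funext => N; rewrite /series/= -[RHS]big_split/=.
by apply: eq_bigr => n _; rewrite -mulrDl.
Qed.

Fact l2inner_Zl (a : K) (c d : l2) : l2inner (a *: c) d = a * l2inner c d.
Proof.
have h : (fun N => a * series (fun n => c n * sconj (d n)) N) @ \oo -->
    a * l2inner c d by apply: cvgMl_tmp; exact: l2inner_cvg.
apply: etrans (cvg_lim _ h); last exact: norm_hausdorff.
congr (limn _); apply/funext => N; rewrite /series/= mulr_sumr.
by apply: eq_bigr => n _; rewrite mulrA.
Qed.

Fact l2innerC (c d : l2) : l2inner c d = sconj (l2inner d c).
Proof.
apply: etrans (cvg_lim _ (cvg_sconj (@l2inner_cvg d c))); last exact: norm_hausdorff.
congr (limn _); apply/funext => N; rewrite /series/= raddf_sum/=.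
by apply: eq_bigr => n _; rewrite rmorphM/= sconjK mulrC.
Qed.

Fact l2innerE (c : l2) : l2inner c c = `|c| ^+ 2.
Proof.
rewrite l2_normE -rmorphXn/= sqr_l2norm.
have -> : l2inner c c =
    limn (fun N => of_real k (\sum_(0 <= n < N) rnorm (c n) ^+ 2)).
  congr (limn _); apply/funext => N; rewrite /series/= raddf_sum/=.
  by apply: eq_bigr => n _; rewrite mul_sconj rmorphXn/= rnormK.
apply: cvg_lim; first exact: norm_hausdorff.
apply: cvg_of_real.
pose s N := (\sum_(0 <= n < N) (rnorm (c n) ^+ 2)%:E)%E.
suff h : s @ \oo --> (fine (sqsum c))%:E.
  have -> : (fun N => \sum_(0 <= n < N) rnorm (c n) ^+ 2) = fine \o s.
    by apply/funext => N; rewrite /s /= sumEFin.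
  exact: fine_cvg.
rewrite -sqsum_fineK; last exact: l2_lty.
by apply: is_cvg_nneseries => n _ _; rewrite lee_fin sqr_ge0.
Qed.

Fact l2inner_zmodl (d : l2) : zmod_morphism (l2inner^~ d).
Proof. by move=> c c'; rewrite l2inner_Dl -scaleN1r l2inner_Zl mulN1r. Qed.

Fact l2inner_scalablel (d : l2) : scalable_for *%R (l2inner^~ d).
Proof. by move=> a c; exact: l2inner_Zl. Qed.

Fact l2inner_zmodr (c : l2) : zmod_morphism (l2inner c).
Proof.
by move=> d d'; rewrite l2innerC l2inner_zmodl raddfB/= -!l2innerC.
Qed.

Fact l2inner_scalabler (c : l2) :
  scalable_for (@sconj R k \; *%R) (l2inner c).
Proof. by move=> a d; rewrite l2innerC l2inner_Zl rmorphM/= -l2innerC. Qed.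

HB.instance Definition _ := isBilinear.Build K l2 l2 K *%R (@sconj R k \; *%R)
  l2inner l2inner_zmodl l2inner_zmodr l2inner_scalablel
  l2inner_scalabler.

Fact l2inner_hermitian (c d : l2) :
  l2inner c d = (-1) ^+ false * sconj (l2inner d c).
Proof. by rewrite mul1r l2innerC. Qed.

HB.instance Definition _ := isHermitianSesquilinear.Build K l2 false
  (@sconj R k) l2inner l2inner_hermitian.

Fact l2inner_gt0 (c : l2) : c != 0 -> 0 < l2inner c c.
Proof. by move=> c0; rewrite l2innerE exprn_gt0// normr_gt0. Qed.

HB.instance Definition _ := isDotProduct.Build K l2 l2inner l2inner_gt0.

HB.instance Definition _ := isInnerProductSpace.Build R k l2 l2innerE.

End SequenceSpace.

Section Operators.
Variables (R : realType) (k : scalar_kind).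
Local Notation K := (scalars R k).

(* [sup] is 0 on unbounded sets, so this is the operator norm only for bounded
   operators. *)
Definition opnorm (V W : normedModType K) (A : V -> W) : R :=
  sup [set rnorm (A x) | x in [set x : V | rnorm x <= 1]].

(* The adjoint is unique when it exists; the value is 0 otherwise. *)
Definition adjoint (V W : innerProductSpaceType R k) (A : V -> W) : W -> V :=
  xget (cst 0)
    [set B : W -> V | forall x y, inner (A x) y = inner x (B y)].

(* The two-sided inverse of a bijective operator, and 0 for other operators. *)
Definition opinv (V : normedModType K) (A : V -> V) : V -> V :=
  xget (cst 0) [set B : V -> V | cancel A B /\ cancel B A].

End Operators.

Definition separable (T : topologicalType) : Prop :=
  exists D : set T, countable D /\ dense D.

Section Frames.
Variables (R : realType) (k : scalar_kind) (H : hilbertType R k).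
Implicit Types (Phi Psi : nat -> H) (m M mu eps : R).

Definition frame_bounds Phi m M : Prop :=
  [/\ 0 < m, 0 < M & forall f : H,
    ((m * rnorm f ^+ 2)%:E <= sqsum (fun n => inner f (Phi n))
                           <= (M * rnorm f ^+ 2)%:E)%E].

Definition is_frame_with_lower_bound Phi m : Prop :=
  exists M, frame_bounds Phi m M.

Definition is_bessel Phi : Prop :=
  exists2 M, 0 < M & forall f : H,
    (sqsum (fun n => inner f (Phi n)) <= (M * rnorm f ^+ 2)%:E)%E.

(* For a Bessel sequence the coefficients are square-summable for every f, so
   the default value 0 of [insubd] is never taken. *)
Definition analysis_op Phi : H -> l2 R k :=
  fun f => insubd 0 (fun n => inner f (Phi n)).

Definition synthesis_op Phi : l2 R k -> H := adjoint (analysis_op Phi).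

Definition frame_op Phi : H -> H := synthesis_op Phi \o analysis_op Phi.

Definition frame_norm Phi : R := opnorm (synthesis_op Phi).

Definition is_perturbation mu Phi Psi : Prop :=
  is_bessel Psi /\ frame_norm (Phi - Psi) <= mu.

Definition canonical_dual Phi : nat -> H :=
  fun n => opinv (frame_op Phi) (Phi n).

Definition canonical_approx_dual Psi (A : H -> H) : nat -> H :=
  fun n => adjoint A (opinv (frame_op Psi) (Psi n)).

Definition is_approximation_rate Psi Psi_ad eps : Prop :=
  0 <= eps < 1 /\
  opnorm (fun f : H => f - synthesis_op Psi (analysis_op Psi_ad f)) <= eps.

End Frames.

(* Main.v *)
From HB Require Import structures.
Require Import Defs.
From mathcomp Require Import all_boot all_order all_algebra.
From mathcomp Require Import ring lra.
From mathcomp Require Import all_classical all_reals all_analysis.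

(** Write [U], [V] for the analysis operators and [T], [T'] for the synthesis
    operators of [Phi], [Psi], and put [S = T U], [R = T' V]. Let [a] be the square
    root of [m] and [b = a - mu]. An operator and its adjoint have the same bounds,
    so the hypothesis on [Psi] says that [U - V] is bounded by [mu], and
    [a |f| <= |U f|] gives [b |f| <= |V f|]. This is the frame property of [Psi].

    The canonical dual of [Phi] has analysis operator [P = U S^-1], and the
    canonical approximate dual of [Psi] has analysis operator [Q A] with
    [Q = V R^-1]. Here [|P| <= 1/a] and [|Q| <= 1/b]. It remains to bound
    [P - Q A = (P - Q) A + P (1 - A)]. Since [T'] maps [Q A f] to [A f], the
    approximation rate controls [1 - A]. As for [P - Q],
      [P - Q = (1 - Q T') (U - V) S^-1 + Q (T' - T) P],
    where [1 - Q T'] is an orthogonal projection. Hence [P - Q] is bounded by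
    [mu / a ^ 2 + mu / (a b)], which is at most [2 mu / (a b)]
    ([dual_analysis_perturbation]).

    Adjoints and inverses of frame operators exist by a Riesz representation
    theorem ([linear_representation]), obtained by minimizing a quadratic
    functional on the Hilbert space. *)

Set Implicit Arguments.
Unset Strict Implicit.

Import Order.TTheory GRing.Theory Num.Theory.
Import numFieldNormedType.Exports.

Local Open Scope classical_set_scope.
Local Open Scope ring_scope.

(** * The real part of an inner product *)

Lemma sqr_le_of_quadratic_ge0 (R : realFieldType) (a b c : R) :
  0 <= c -> (forall t, 0 <= a + 2 * t * b + t ^+ 2 * c) -> b ^+ 2 <= a * c.
Proof.
rewrite le_eqVlt => /predU1P[<-|c0] h.
  rewrite mulr0; have [->|b0] := eqVneq b 0; first by rewrite expr0n.
  have := h (- (a + 1) / (2 * b)); rewrite mulr0 addr0.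
  rewrite (_ : 2 * _ * b = - (a + 1)); last by field.
  by lra.
have := h (- b / c).
rewrite (_ : a + _ + _ = (a * c - b ^+ 2) / c); last by field; rewrite gt_eqF.
by rewrite pmulr_lge0 ?invr_gt0// subr_ge0.
Qed.

Section RealInnerProduct.
Variables (R : realType) (k : scalar_kind).
Local Notation K := (scalars R k).

Lemma sre_sconj (a : K) : sre (sconj a) = sre a.
Proof. by move: a; rewrite /sre /sconj; case: k => // -[]. Qed.

Lemma sre_of_realM (t : R) (a : K) : sre (of_real k t * a) = t * sre a.
Proof.
by move: a; rewrite /sre /of_real; case: k => // -[x y] /=; rewrite mul0r subr0.
Qed.

Lemma sre_le_rnorm (a : K) : sre a <= rnorm a.
Proof.
rewrite -(ler_of_real k) rnormK.
move: a; rewrite /sre /of_real; case: k => /= a; first exact: ler_norm.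
apply: le_trans (complex.normc_ge_Re a); rewrite complex.lecR; exact: ler_norm.
Qed.

Lemma sqr_rnorm_scalar (a : K) : sre (sconj a * a) = rnorm a ^+ 2.
Proof.
apply: (can_inj (@of_realK R k)).
by rewrite mulrC mul_sconj rmorphXn/= rnormK -rnormK -rmorphXn/= of_realK.
Qed.

Section NormedSpace.
Variable V : normedModType K.
Implicit Types x : V.

Lemma rnorm0 : rnorm (0 : V) = 0.
Proof. by rewrite /rnorm normr0 raddf0. Qed.

Lemma rnormN x : rnorm (- x) = rnorm x.
Proof. by rewrite /rnorm normrN. Qed.

Lemma rnorm_eq0 x : rnorm x = 0 -> x = 0.
Proof. by move=> h; apply/normr0_eq0; rewrite -rnormK h rmorph0. Qed.

End NormedSpace.

Section RealForm.
Variable V : innerProductSpaceType R k.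
Implicit Types x y z : V.

(** The real part of the inner product. It is a symmetric real bilinear form
    with the same norm, which allows the estimates to be carried out over the
    reals whatever the scalars are. *)
Definition rip x y : R := sre (inner x y).

Lemma inner_conj x y : inner x y = sconj (inner y x).
Proof. by rewrite hermC mul1r. Qed.

Lemma ripC x y : rip x y = rip y x.
Proof. by rewrite /rip inner_conj sre_sconj. Qed.

Lemma rip_sqr x : rip x x = rnorm x ^+ 2.
Proof.
apply: (can_inj (@of_realK R k)).
by rewrite /rip innerE -rnormK -!rmorphXn/= !of_realK.
Qed.

Lemma ripDl x y z : rip (x + y) z = rip x z + rip y z.
Proof. by rewrite /rip linearDl raddfD. Qed.

Lemma ripBl x y z : rip (x - y) z = rip x z - rip y z.
Proof. by rewrite /rip linearBl raddfB. Qed.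

Lemma ripDr x y z : rip x (y + z) = rip x y + rip x z.
Proof. by rewrite ripC ripDl !(ripC x). Qed.

Lemma ripBr x y z : rip x (y - z) = rip x y - rip x z.
Proof. by rewrite ripC ripBl !(ripC x). Qed.

Lemma ripZl (t : R) x y : rip (of_real k t *: x) y = t * rip x y.
Proof. by rewrite /rip linearZl_LR sre_of_realM. Qed.

Lemma ripZr (t : R) x y : rip x (of_real k t *: y) = t * rip x y.
Proof. by rewrite ripC ripZl ripC. Qed.

Lemma rnorm_sqrD (t : R) x y :
  rnorm (x + of_real k t *: y) ^+ 2 =
  rnorm x ^+ 2 + 2 * t * rip x y + t ^+ 2 * rnorm y ^+ 2.
Proof.
rewrite -!rip_sqr ripDl !ripDr !ripZl !ripZr (ripC y x); ring.
Qed.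

(** Cauchy-Schwarz for the real form: the square norm of [x + t y] is a nonnegative quadratic
    polynomial in [t]. *)
Lemma rip_le x y : `|rip x y| <= rnorm x * rnorm y.
Proof.
rewrite -(@ler_pXn2r _ 2)// ?nnegrE ?mulr_ge0 ?rnorm_ge0//.
rewrite real_normK ?num_real// exprMn.
apply: sqr_le_of_quadratic_ge0; first exact: sqr_ge0.
by move=> t; rewrite -rnorm_sqrD sqr_ge0.
Qed.

(** The full Cauchy-Schwarz inequality follows from the one for the real form by
    scaling [x] with the conjugate of [inner x y]. *)
Lemma rnorm_inner_le (x y : V) :
  rnorm (inner x y) <= rnorm x * rnorm y.
Proof.
have [a0|a0] := eqVneq (rnorm (inner x y)) 0.
  by rewrite a0 mulr_ge0 ?rnorm_ge0.
have ap : 0 < rnorm (inner x y) by rewrite lt_neqAle eq_sym a0 rnorm_ge0.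
rewrite -(ler_pM2l ap) mulrA -expr2 -[in leRHS](rnorm_sconj (inner x y)) -rnormZ.
apply: le_trans (rip_le _ _); apply: le_trans (ler_norm _).
by rewrite /rip linearZl_LR/= sqr_rnorm_scalar.
Qed.

Lemma inner_injr (y z : V) :
  (forall x, inner x y = inner x z) -> y = z.
Proof.
move=> h; apply/eqP; rewrite -subr_eq0; apply/eqP/rnorm_eq0/eqP.
by rewrite -sqrf_eq0 -rip_sqr ripBr /rip h subrr.
Qed.

End RealForm.
End RealInnerProduct.

(** * Riesz representation *)

Section Representation.
Variables (R : realType) (k : scalar_kind).
Local Notation K := (scalars R k).

(** Completeness of a Hilbert space in terms of the real-valued norm. *)
Lemma cauchy_rnorm_cvg (V : hilbertType R k) (x : nat -> V) :
  (forall e : R, 0 < e ->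
    exists N, forall n p, (N <= n)%N -> (N <= p)%N -> rnorm (x n - x p) < e) ->
  exists z, forall e : R, 0 < e -> \forall n \near \oo, rnorm (z - x n) < e.
Proof.
move=> h.
have cx : cvgn x.
  apply/cauchy_cvgP/cauchy_exP => e e0.
  have e0' : 0 < sre e by rewrite -(ltr_of_real k) sreK ?rmorph0// ltW.
  have [N hN] := h _ e0'.
  exists (x N); exists N => // n /= Nn.
  rewrite -ball_normE /ball_ /= -rnormK -(sreK (ltW e0)) ltr_of_real.
  exact: hN.
have /cvg_ex[z hz] := cx.
exists z => e e0; move/cvgrPdist_lt : hz => /(_ (of_real k e)).
rewrite -(rmorph0 (of_real k)) ltr_of_real => /(_ e0).
by apply: filterS => n; rewrite -rnormK ltr_of_real.
Qed.

(** Riesz representation for the inner product [inner (U v) (U z)], where [U] is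
    bounded and bounded below. The vector [z] minimizes
    [rnorm (U x) ^+ 2 - 2 * sre (g x)]. With [U] the identity this is the usual
    Riesz theorem; with [U] an analysis operator it solves the equation
    [frame_op Phi z = y]. *)
Lemma linear_representation (V : hilbertType R k) (W : innerProductSpaceType R k)
    (U : {linear V -> W}) (g : {scalar V}) (C c G : R) :
  (forall x, rnorm (U x) <= C * rnorm x) ->
  0 < c -> (forall x, c * rnorm x <= rnorm (U x)) ->
  (forall x, rnorm (g x) <= G * rnorm x) ->
  exists z, forall v, g v = inner (U v) (U z).
Proof.
move=> hC c0 hc hG.
pose J x := rnorm (U x) ^+ 2 - 2 * sre (g x).
pose I := inf (range J).
have Jlb : has_inf (range J).
  split; first by exists (J 0), 0.
  exists (- (G / c) ^+ 2) => _ [x _ <-]; rewrite /J.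
  have h1 : (c * rnorm x) ^+ 2 <= rnorm (U x) ^+ 2.
    by rewrite ler_pXn2r// ?nnegrE ?mulr_ge0 ?rnorm_ge0// ltW.
  have h2 := le_trans (sre_le_rnorm (g x)) (hG x).
  have h3 : 0 <= (c * rnorm x - G / c) ^+ 2 by exact: sqr_ge0.
  have : (c * rnorm x - G / c) ^+ 2 =
      (c * rnorm x) ^+ 2 - 2 * (G * rnorm x) + (G / c) ^+ 2.
    by field; rewrite gt_eqF.
  by lra.
have IJ x : I <= J x by apply: ge_inf; [exact: Jlb.2|exists x].
(* Almost minimizers of J almost satisfy the Euler-Lagrange equation b = 0. *)
pose b x v := rip (U v) (U x) - sre (g v).
have key (e : R) x v : J x <= I + e -> b x v ^+ 2 <= e * rnorm (U v) ^+ 2.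
  move=> hx; apply: sqr_le_of_quadratic_ge0; first exact: sqr_ge0.
  move=> t; have := le_trans hx (lerD (IJ (x + of_real k t *: v)) (lexx e)).
  rewrite /J (linearD U) (linearZ_LR U) (linearD g) (linearZ_LR g)/= raddfD/=.
  rewrite sre_of_realM rnorm_sqrD /b -subr_ge0 (ripC (U v)) => h.
  by apply: le_trans h _; rewrite le_eqVlt; apply/orP; left; apply/eqP; ring.
have /choice[x_ hx_] (n : nat) : exists x, J x <= I + n.+1%:R^-1.
  have n0 : 0 < n.+1%:R^-1 :> R by rewrite invr_gt0.
  by have [_ [x _ <-] hx] := inf_adherent n0 Jlb; exists x; exact: ltW.
have small (e : R) : 0 < e -> exists N, forall n, (N <= n)%N -> n.+1%:R^-1 < e.
  move=> e0; have [N _ hN] := near_infty_natSinv_lt (PosNum e0).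
  by exists N => n Nn; apply: hN.
(* For v = x_ n - x_ p the square norm N of U v is the difference of the two
   defects b, whence N ^ 2 <= 4 d N once both squares are at most d N. As U is
   bounded below, minimizing sequences are Cauchy; the factor 8 in d makes the
   inequality strict. *)
have [|z hz] := @cauchy_rnorm_cvg V x_.
  move=> e e0; have d0 : 0 < c ^+ 2 * e ^+ 2 / 8.
    by rewrite divr_gt0// mulr_gt0// exprn_gt0.
  have [N hN] := small _ d0; exists N => n p Nn Np.
  set d := _ / 8 in d0 hN.
  set v := x_ n - x_ p.
  have h1 : b (x_ n) v ^+ 2 <= d * rnorm (U v) ^+ 2.
    by apply: key; apply: le_trans (hx_ n) _; rewrite lerD2l ltW// hN.
  have h2 : b (x_ p) v ^+ 2 <= d * rnorm (U v) ^+ 2.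
    by apply: key; apply: le_trans (hx_ p) _; rewrite lerD2l ltW// hN.
  have h3 : rnorm (U v) ^+ 2 = b (x_ n) v - b (x_ p) v.
    transitivity (rip (U v) (U (x_ n) - U (x_ p))).
      by rewrite -(linearB U) rip_sqr.
    by rewrite ripBr /b; ring.
  rewrite ltNge; apply/negP => ev.
  have h4 : c ^+ 2 * e ^+ 2 <= rnorm (U v) ^+ 2.
    rewrite -exprMn ler_pXn2r// ?nnegrE ?rnorm_ge0// ?mulr_ge0 ?(ltW c0) ?(ltW e0)//.
    by apply: le_trans (hc v); rewrite ler_pM2l.
  have h5 : 0 < rnorm (U v) ^+ 2.
    by apply: lt_le_trans h4; rewrite mulr_gt0// exprn_gt0.
  have h6 : 8 * d = c ^+ 2 * e ^+ 2 by rewrite /d; field.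
  have h7 : 0 <= (b (x_ n) v + b (x_ p) v) ^+ 2 by exact: sqr_ge0.
  have h8 : 0 < rnorm (U v) ^+ 2 * rnorm (U v) ^+ 2 by rewrite mulr_gt0.
  have h9 : 8 * d * rnorm (U v) ^+ 2 <= rnorm (U v) ^+ 2 * rnorm (U v) ^+ 2.
    by rewrite ler_pM2r// h6.
  have : rnorm (U v) ^+ 2 * rnorm (U v) ^+ 2 = (b (x_ n) v - b (x_ p) v) ^+ 2.
    by rewrite -h3 expr2.
  rewrite sqrrB; rewrite sqrrD in h7.
  by lra.
exists z => v; apply/eqP; rewrite -subr_eq0; apply/eqP/rnorm_eq0.
(* It is enough that the real part of g v - inner (U v) (U z) vanishes for all v,
   since v may be scaled by the conjugate of that difference. *)
suff bz w : b z w = 0.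
  apply/eqP; rewrite -sqrf_eq0 -sqr_rnorm_scalar; apply/eqP.
  set a := sconj _.
  have := bz (a *: v); rewrite /b /rip !linearZ/= linearZl_LR/= => h.
  by rewrite mulrBr raddfB/= -(opprB (sre _)) h oppr0.
apply/normr0_eq0/le_anti; rewrite normr_ge0 andbT.
apply/ler_addgt0Pr => e e0; rewrite add0r.
have [r r0 Ur] : exists2 r, 0 < r & rnorm (U w) <= r.
  by exists (rnorm (U w) + 1); rewrite ?lerDl// ltr_wpDl// rnorm_ge0.
have [D D0 CD] : exists2 D, 0 < D & C <= D.
  by exists (`|C| + 1); [rewrite ltr_wpDl | rewrite ler_wpDr ?ler_norm].
have q0 : 0 < e / (2 * r) by rewrite divr_gt0// mulr_gt0.
have d0 : 0 < (e / (2 * r)) ^+ 2 by rewrite exprn_gt0.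
have [N hN] := small _ d0.
have d'0 : 0 < e / (2 * r * D) by rewrite divr_gt0// !mulr_gt0.
have [M _ hM] := hz _ d'0.
pose n := maxn N M.
have := hN n (leq_maxl _ _); have := hM n (leq_maxr _ _) => /= h1 h2.
have h3 : `|b (x_ n) w| <= e / 2.
  rewrite -(@ler_pXn2r _ 2)// ?nnegrE ?normr_ge0 ?divr_ge0 ?(ltW e0)//.
  rewrite real_normK ?num_real//.
  have hk : J (x_ n) <= I + (e / (2 * r)) ^+ 2.
    by apply: le_trans (hx_ n) _; rewrite lerD2l ltW.
  apply: le_trans (key _ _ _ hk) _.
  have e20 : 0 <= e / 2 by rewrite ltW// divr_gt0.
  have hr : e / (2 * r) * rnorm (U w) <= e / 2.
    rewrite [leRHS](_ : _ = e / (2 * r) * r); last by field; rewrite gt_eqF.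
    by rewrite ler_pM2l.
  have hl : 0 <= e / (2 * r) * rnorm (U w).
    by rewrite mulr_ge0 ?rnorm_ge0 ?(ltW q0).
  by rewrite -exprMn; apply: lerXn2r hr; rewrite nnegrE.
have h4 : b z w = b (x_ n) w + rip (U w) (U (z - x_ n)).
  by rewrite /b (linearB U) ripBr; ring.
have h5 : `|rip (U w) (U (z - x_ n))| <= e / 2.
  apply: le_trans (rip_le _ _) _.
  have h6 : rnorm (U (z - x_ n)) <= D * (e / (2 * r * D)).
    apply: le_trans (hC _) _.
    by apply: (@le_trans _ _ (D * rnorm (z - x_ n)));
      [rewrite ler_wpM2r ?rnorm_ge0 | rewrite ler_pM2l// ltW].
  rewrite [leRHS](_ : _ = r * (D * (e / (2 * r * D)))); last first.
    by field; rewrite !gt_eqF.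
  by apply: ler_pM; rewrite ?rnorm_ge0.
rewrite h4; apply: le_trans (ler_normD _ _) _.
by rewrite [leRHS]splitr lerD.
Qed.

End Representation.

(** * Bounded operators and adjoints *)

Section Operators.
Variables (R : realType) (k : scalar_kind).
Local Notation K := (scalars R k).

Section OpNorm.
Variables (V W : normedModType K) (A : V -> W).

(** No boundedness is needed, as [sup] vanishes on unbounded sets. *)
Lemma opnorm_ge0 : 0 <= opnorm A.
Proof.
rewrite /opnorm; set S := [set _ | _ in _].
have S0 : S (rnorm (A 0)) by exists 0 => //=; rewrite rnorm0.
have [hS|hS] := pselect (has_sup S); last by rewrite sup_out.
exact: le_trans (rnorm_ge0 (A 0)) (ub_le_sup hS.2 S0).
Qed.

Lemma opnorm_le (C : R) : 0 <= C ->
  (forall x, rnorm (A x) <= C * rnorm x) -> opnorm A <= C.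
Proof.
move=> C0 h; apply: ge_sup.
  by exists (rnorm (A 0)), 0 => //=; rewrite rnorm0.
move=> _ [x /= x1 <-]; apply: le_trans (h x) _.
by rewrite -[leRHS]mulr1 ler_wpM2l.
Qed.

(** Some bound [C] has to be known: [opnorm] vanishes on unbounded operators. *)
Lemma le_opnorm (C : R) : scalable A ->
  (forall x, rnorm (A x) <= C * rnorm x) ->
  forall x, rnorm (A x) <= opnorm A * rnorm x.
Proof.
move=> hA h x.
have [x0|x0] := eqVneq (rnorm x) 0.
  by have := h x; rewrite x0 !mulr0.
have xp : 0 < rnorm x by rewrite lt_neqAle eq_sym x0 rnorm_ge0.
have rt : rnorm (of_real k (rnorm x)^-1) = (rnorm x)^-1.
  by rewrite /rnorm norm_of_real of_realK ger0_norm// invr_ge0 ltW.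
rewrite -ler_pdivrMr// mulrC -rt -rnormZ -hA; apply: ub_le_sup.
  exists `|C| => _ [y /= y1 <-]; apply: le_trans (h y) _.
  apply: (@le_trans _ _ (`|C| * rnorm y)).
    by rewrite ler_wpM2r ?rnorm_ge0// ler_norm.
  by rewrite -[leRHS]mulr1 ler_wpM2l.
by exists (of_real k (rnorm x)^-1 *: x) => //=; rewrite rnormZ rt mulVf.
Qed.

End OpNorm.

Lemma continuous_linear_le (V W : normedModType K) (A : {linear V -> W}) :
  continuous A -> exists C : R, forall x, rnorm (A x) <= C * rnorm x.
Proof.
move=> /(linear_bounded_continuous A).2 /(linear_boundedP A).1.
move=> /pinfty_ex_gt0[r r0 hr].
exists (sre r) => x.
by rewrite -(ler_of_real k) rmorphM/= !rnormK sreK ?(ltW r0)// hr.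
Qed.

Section Adjoint.
Variables (V : hilbertType R k) (W : innerProductSpaceType R k).
Variables (U : {linear V -> W}) (C : R).
Hypothesis U_le : forall x, rnorm (U x) <= C * rnorm x.

(** Existence of the adjoint of a bounded operator on a Hilbert space. *)
Lemma adjointP x y : inner (U x) y = inner x (adjoint U y).
Proof.
suff : [set B : W -> V | forall x y, inner (U x) y = inner x (B y)] (adjoint U).
  exact.
apply: xgetPex.
suff /choice[B hB] : forall y, exists z, forall x, inner (U x) y = inner x z.
  by exists B => u v /=; exact: hB.
move=> {}y.
have lin : linear_for *%R (fun x => inner (U x) y).
  by move=> a u v; rewrite linearP linearDl linearZl_LR.
pose g : {scalar V} := HB.pack (fun x => inner (U x) y)
  (GRing.isLinear.Build K V K *%R _ lin).
apply: (@linear_representation _ _ V V idfun g 1 1 (C * rnorm y)) => //.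
- by move=> v; rewrite mul1r.
- by move=> v; rewrite mul1r.
- move=> v; apply: le_trans (rnorm_inner_le _ _) _.
  by rewrite mulrAC ler_wpM2r ?rnorm_ge0.
Qed.

Lemma adjoint_scalable : scalable (adjoint U).
Proof.
move=> a y; apply: inner_injr => x.
by rewrite -adjointP !linearZr_LR/= adjointP.
Qed.

Lemma rnorm_adjoint_le y : 0 <= C -> rnorm (adjoint U y) <= C * rnorm y.
Proof.
move=> C0; have [a0|a0] := eqVneq (rnorm (adjoint U y)) 0.
  by rewrite a0 mulr_ge0 ?rnorm_ge0.
have ap : 0 < rnorm (adjoint U y) by rewrite lt_neqAle eq_sym a0 rnorm_ge0.
rewrite -(ler_pM2l ap) -expr2 -rip_sqr /rip -adjointP.
apply: le_trans (ler_norm _) _; apply: le_trans (rip_le _ _) _.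
by rewrite mulrA ler_wpM2r ?rnorm_ge0// mulrC.
Qed.

End Adjoint.
End Operators.

(** * Bessel sequences *)

Section BesselSequences.
Variables (R : realType) (k : scalar_kind) (H : hilbertType R k).
Local Notation K := (scalars R k).
Implicit Types Phi Psi : nat -> H.

Lemma rnorm_l2 (c : l2 R k) : rnorm c = l2norm c.
Proof. by rewrite /rnorm l2_normE of_realK. Qed.

Lemma sqsum_l2 (c : l2 R k) : sqsum c = (rnorm c ^+ 2)%:E.
Proof. by rewrite rnorm_l2 sqr_l2norm -sqsum_fineK// l2_lty. Qed.

Lemma bessel_analysisE Phi f n : is_bessel Phi ->
  analysis_op Phi f n = inner f (Phi n).
Proof.
move=> [M _ hM]; rewrite /analysis_op; move: n; apply/funeqP.
by apply: insubdK; apply/square_summableP; apply: le_lt_trans (hM f) (ltry _).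
Qed.

Lemma bessel_sqsum Phi f : is_bessel Phi ->
  sqsum (fun n => inner f (Phi n)) = (rnorm (analysis_op Phi f) ^+ 2)%:E.
Proof.
move=> h; rewrite -sqsum_l2; congr (sqsum _).
by apply/funext => n; rewrite bessel_analysisE.
Qed.

Lemma bessel_analysis_le Phi : is_bessel Phi ->
  exists2 C, 0 <= C & forall f, rnorm (analysis_op Phi f) <= C * rnorm f.
Proof.
move=> h; have [M M0 hM] := h; exists (Num.sqrt M) => [|f]; first exact: sqrtr_ge0.
have := hM f; rewrite bessel_sqsum// lee_fin => hf.
rewrite -(@ler_pXn2r _ 2)// ?nnegrE ?mulr_ge0 ?sqrtr_ge0 ?rnorm_ge0//.
by rewrite exprMn sqr_sqrtr// ltW.
Qed.

(** This identifies the analysis operators of differences and of dual sequences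
    from their coefficients. *)
Lemma bessel_of_bounded_map Phi (c : H -> l2 R k) (C : R) :
  (forall f n, inner f (Phi n) = c f n) ->
  (forall f, rnorm (c f) <= C * rnorm f) ->
  is_bessel Phi /\ forall f, analysis_op Phi f = c f.
Proof.
move=> hc hC.
have hb : is_bessel Phi.
  exists (C ^+ 2 + 1) => [|f]; first by rewrite ltr_wpDl ?sqr_ge0.
  have -> : (fun n => inner f (Phi n)) = c f by apply/funext => n; rewrite hc.
  rewrite sqsum_l2 lee_fin.
  apply: (@le_trans _ _ ((C * rnorm f) ^+ 2)).
    by apply: lerXn2r (hC f); rewrite nnegrE ?rnorm_ge0// (le_trans _ (hC f)) ?rnorm_ge0.
  by rewrite exprMn ler_wpM2r ?sqr_ge0// lerDl.
split=> // f; apply/val_inj/funext => n.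
by rewrite [LHS]bessel_analysisE // hc.
Qed.

Lemma analysis_linear Phi : is_bessel Phi -> linear (analysis_op Phi).
Proof.
move=> h a f g; apply/val_inj/funext => n.
by rewrite [LHS]bessel_analysisE// linearDl linearZl_LR /= -!(bessel_analysisE _ _ h).
Qed.

Section Bessel.
Variables (Phi : nat -> H) (bessel_Phi : is_bessel Phi).

(** The analysis operator of a Bessel sequence, as a linear map. *)
Definition analysis_lin : {linear H -> l2 R k} := HB.pack (analysis_op Phi)
  (GRing.isLinear.Build K H (l2 R k) *:%R _ (analysis_linear bessel_Phi)).

Lemma analysisD f g :
  analysis_op Phi (f + g) = analysis_op Phi f + analysis_op Phi g.
Proof. exact: (linearD analysis_lin). Qed.

Lemma analysisB f g :
  analysis_op Phi (f - g) = analysis_op Phi f - analysis_op Phi g.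
Proof. exact: (linearB analysis_lin). Qed.

Lemma synthesisP f c :
  inner (analysis_op Phi f) c = inner f (synthesis_op Phi c).
Proof.
have [C _ hC] := bessel_analysis_le bessel_Phi.
exact: (@adjointP _ _ _ _ analysis_lin C hC).
Qed.

Lemma rip_synthesis f c :
  rip (analysis_op Phi f) c = rip f (synthesis_op Phi c).
Proof. by rewrite /rip synthesisP. Qed.

Lemma rnorm_synthesis_le (C : R) : 0 <= C ->
  (forall f, rnorm (analysis_op Phi f) <= C * rnorm f) ->
  forall c, rnorm (synthesis_op Phi c) <= C * rnorm c.
Proof.
by move=> C0 hC c; exact: (@rnorm_adjoint_le _ _ _ _ analysis_lin C hC c C0).
Qed.

Lemma frame_norm_le (C : R) : 0 <= C ->
  (forall f, rnorm (analysis_op Phi f) <= C * rnorm f) -> frame_norm Phi <= C.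
Proof. by move=> C0 hC; apply: opnorm_le => //; exact: rnorm_synthesis_le. Qed.

(** The analysis operator inherits the bound of its adjoint, the synthesis
    operator. *)
Lemma rnorm_analysis_le_frame_norm f :
  rnorm (analysis_op Phi f) <= frame_norm Phi * rnorm f.
Proof.
have [C C0 hC] := bessel_analysis_le bessel_Phi.
have hs : scalable (synthesis_op Phi).
  exact: (@adjoint_scalable _ _ _ _ analysis_lin C hC).
have hT := le_opnorm hs (rnorm_synthesis_le C0 hC).
set u := analysis_op Phi f.
have [u0|u0] := eqVneq (rnorm u) 0.
  by rewrite u0 mulr_ge0 ?rnorm_ge0// opnorm_ge0.
have up : 0 < rnorm u by rewrite lt_neqAle eq_sym u0 rnorm_ge0.
rewrite -(ler_pM2l up) -expr2 -rip_sqr {1}/u rip_synthesis.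
apply: le_trans (ler_norm _) _; apply: le_trans (rip_le _ _) _.
apply: le_trans (ler_wpM2l (rnorm_ge0 _) (hT u)) _.
by rewrite le_eqVlt; apply/orP; left; apply/eqP; rewrite /frame_norm; ring.
Qed.

End Bessel.
End BesselSequences.

(** * Inverse frame operator and canonical dual *)

Section CanonicalDual.
Variables (R : realType) (k : scalar_kind) (H : hilbertType R k).
Local Notation K := (scalars R k).

Section InverseFrameOperator.
Variables (Phi : nat -> H) (bessel_Phi : is_bessel Phi) (a : R).
Hypotheses (a0 : 0 < a)
  (lower : forall f, a * rnorm f <= rnorm (analysis_op Phi f)).
Local Notation U := (analysis_op Phi).
Local Notation S := (frame_op Phi).
Local Notation S' := (opinv S).

Lemma inner_frame_op f g : inner f (S g) = inner (U f) (U g).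
Proof. by rewrite synthesisP. Qed.

(** The frame operator of a Bessel sequence whose analysis operator is bounded
    below is bijective, hence [opinv] inverts it. *)
Lemma frame_op_bij : cancel S S' /\ cancel S' S.
Proof.
suff : [set B : H -> H | cancel S B /\ cancel B S] S' by [].
apply: xgetPex.
have Sinj : injective S.
  move=> f g e; apply/eqP; rewrite -subr_eq0; apply/eqP/rnorm_eq0/le_anti.
  rewrite rnorm_ge0 andbT -(pmulr_rle0 _ a0); apply: le_trans (lower _) _.
  suff -> : rnorm (U (f - g)) = 0 by [].
  apply/eqP; rewrite -sqrf_eq0 -rip_sqr {2}analysisB// ripBr.
  by rewrite !rip_synthesis// -[synthesis_op _ _]/(S f) e subrr.
suff /choice[B hB] : forall y, exists z, S z = y.
  by exists B; split => // x; apply: Sinj.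
move=> y.
have lin : linear_for *%R (fun x => inner x y).
  by move=> b u v; rewrite linearDl linearZl_LR.
pose g : {scalar H} := HB.pack (fun x => inner x y)
  (GRing.isLinear.Build K H K *%R _ lin).
have [C _ hC] := bessel_analysis_le bessel_Phi.
have [|z hz] := @linear_representation _ _ H _ (analysis_lin bessel_Phi) g C a
    (rnorm y) hC a0 lower.
  by move=> v; rewrite mulrC; exact: rnorm_inner_le.
by exists z; apply: inner_injr => v; rewrite inner_frame_op; exact/esym/hz.
Qed.

Lemma opinvK f : S (S' f) = f. Proof. exact: frame_op_bij.2. Qed.

(** The inverse of the frame operator is self-adjoint. *)
Lemma inner_opinv f g : inner (S' f) g = inner f (S' g).
Proof.
rewrite -{1}(opinvK g) inner_frame_op inner_conj -inner_frame_op opinvK.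
by rewrite -inner_conj.
Qed.

(** The sequence of coefficients of [f] in the canonical dual of [Phi]. It lies
    in the range of the analysis operator and synthesizes back to [f]; see
    [rip_dual_analysis]. *)
Definition dual_analysis f := U (S' f).

Lemma rip_dual_analysis f g : rip (U g) (dual_analysis f) = rip g f.
Proof. by rewrite rip_synthesis// -[synthesis_op _ _]/(S (S' f)) opinvK. Qed.

Lemma rnorm_dual_analysis_le f : rnorm (dual_analysis f) <= a^-1 * rnorm f.
Proof.
have [p0|p0] := eqVneq (rnorm (dual_analysis f)) 0.
  by rewrite p0 mulr_ge0 ?rnorm_ge0// invr_ge0 ltW.
have pp : 0 < rnorm (dual_analysis f) by rewrite lt_neqAle eq_sym p0 rnorm_ge0.
rewrite ler_pdivlMl// -(ler_pM2r pp) -mulrA -expr2 -rip_sqr rip_dual_analysis.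
apply: (@le_trans _ _ (a * (rnorm (S' f) * rnorm f))).
  rewrite ler_pM2l//; apply: le_trans (ler_norm _) (rip_le _ _).
by rewrite mulrA mulrC ler_wpM2l ?rnorm_ge0// lower.
Qed.

Lemma rnorm_opinv_le f : rnorm (S' f) <= a^-1 * (a^-1 * rnorm f).
Proof.
by rewrite ler_pdivlMl//; apply: le_trans (lower _) (rnorm_dual_analysis_le f).
Qed.

Lemma dual_analysisB f g :
  dual_analysis (f - g) = dual_analysis f - dual_analysis g.
Proof.
rewrite /dual_analysis -analysisB//; congr analysis_op.
by apply: inner_injr => x; rewrite -inner_opinv !linearBr/= !inner_opinv.
Qed.

End InverseFrameOperator.
End CanonicalDual.

(** * Perturbation of canonical duals *)

Section Perturbation.
Variables (R : realType) (k : scalar_kind) (H : hilbertType R k).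
Implicit Types Phi Psi : nat -> H.

Lemma frame_lower_bound_analysis Phi m : is_frame_with_lower_bound Phi m ->
  [/\ is_bessel Phi, 0 < Num.sqrt m &
      forall f, Num.sqrt m * rnorm f <= rnorm (analysis_op Phi f)].
Proof.
move=> [M [m0 M0 hM]].
have hb : is_bessel Phi by exists M => // f; have /andP[] := hM f.
split=> //; first by rewrite sqrtr_gt0.
move=> f; have /andP[+ _] := hM f; rewrite bessel_sqsum// lee_fin => hf.
rewrite -(@ler_pXn2r _ 2)// ?nnegrE ?mulr_ge0 ?sqrtr_ge0 ?rnorm_ge0//.
by rewrite exprMn sqr_sqrtr// ltW.
Qed.

Lemma bessel_frame_lower_bound Phi (a : R) : is_bessel Phi -> 0 < a ->
  (forall f, a * rnorm f <= rnorm (analysis_op Phi f)) ->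
  is_frame_with_lower_bound Phi (a ^+ 2).
Proof.
move=> hb a0 lower; have [M M0 hM] := hb; exists M; split=> //.
  by rewrite exprn_gt0.
move=> f; rewrite hM andbT bessel_sqsum// lee_fin -exprMn.
by rewrite lerXn2r ?nnegrE ?mulr_ge0 ?rnorm_ge0 ?(ltW a0).
Qed.

Lemma bessel_sub Phi Psi : is_bessel Phi -> is_bessel Psi ->
  is_bessel (Phi - Psi) /\
  forall f, analysis_op (Phi - Psi) f = analysis_op Phi f - analysis_op Psi f.
Proof.
move=> hPhi hPsi.
have [C C0 hC] := bessel_analysis_le hPhi.
have [D D0 hD] := bessel_analysis_le hPsi.
apply: (@bessel_of_bounded_map _ _ _ _ _ (C + D)) => [f n|f].
  by rewrite [LHS]linearBr/= -!bessel_analysisE.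
apply: le_trans (rnormD _ _) _; rewrite rnormN mulrDl.
by apply: lerD.
Qed.

Section DualPerturbation.
Variables (Phi Psi : nat -> H) (a b mu : R).
Hypotheses (bessel_Phi : is_bessel Phi) (bessel_Psi : is_bessel Psi).
Hypotheses (a0 : 0 < a) (b0 : 0 < b) (mu0 : 0 <= mu).
Hypotheses
  (lower_Phi : forall f, a * rnorm f <= rnorm (analysis_op Phi f))
  (lower_Psi : forall f, b * rnorm f <= rnorm (analysis_op Psi f))
  (close : forall f, rnorm (analysis_op Phi f - analysis_op Psi f) <= mu * rnorm f).
Local Notation U := (analysis_op Phi).
Local Notation V := (analysis_op Psi).
Local Notation P := (dual_analysis Phi).
Local Notation Q := (dual_analysis Psi).

(** The vector [Q (synthesis_op Psi d)] is the orthogonal projection of [d] onto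
    the range of [V]. *)
Lemma dual_residual_le d :
  rnorm (d - Q (synthesis_op Psi d)) <= rnorm d.
Proof.
set y := synthesis_op Psi d.
have e1 : rip d (Q y) = rnorm (Q y) ^+ 2.
  rewrite ripC rip_synthesis// -/y.
  by rewrite -rip_sqr (rip_dual_analysis bessel_Psi b0 lower_Psi).
rewrite -(@ler_pXn2r _ 2)// ?nnegrE ?rnorm_ge0//.
rewrite -!rip_sqr ripBl !ripBr (ripC (Q y) d) e1 -!rip_sqr.
by rewrite (rip_sqr (Q y)) subrr subr0 gerBl sqr_ge0.
Qed.

(** The difference of the dual analysis operators splits into a residual of the
    projection onto the range of [V], applied to [(U - V) S^-1 f], and an element
    of that range. *)
Lemma dual_analysis_perturbation f :
  rnorm (P f - Q f) <= (mu * a^-1 * a^-1 + mu * a^-1 * b^-1) * rnorm f.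
Proof.
have [g [Pg g_le gE]] : exists g, [/\ P f = U g,
    rnorm g <= a^-1 * (a^-1 * rnorm f) & forall x, rip (U x) (U g) = rip x f].
  exists (opinv (frame_op Phi) f); split=> //.
    exact: (rnorm_opinv_le bessel_Phi a0 lower_Phi).
  by move=> x; exact: (rip_dual_analysis bessel_Phi a0 lower_Phi f x).
have [h [Qh hE]] : exists h,
    Q f = V h /\ forall x, rip (V x) (V h) = rip x f.
  exists (opinv (frame_op Psi) f); split=> // x.
  exact: (rip_dual_analysis bessel_Psi b0 lower_Psi f x).
pose d : l2 R k := U g - V g.
have [w [w_le wE]] : exists w,
    rnorm (d - V w) <= rnorm d /\ forall x, rip (V x) (V w) = rip (V x) d.
  exists (opinv (frame_op Psi) (synthesis_op Psi d)).
  split=> [|x]; first exact: (dual_residual_le d).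
  rewrite [RHS]rip_synthesis//.
  exact: (rip_dual_analysis bessel_Psi b0 lower_Psi (synthesis_op Psi d) x).
have Pf := rnorm_dual_analysis_le bessel_Phi a0 lower_Phi f.
rewrite Pg in Pf; rewrite Pg Qh.
pose v := g + w - h.
have Vv : V v = V g + V w - V h by rewrite /v analysisB// analysisD.
have -> : U g - V h = (d - V w) + V v.
  have -> : d - V w = U g - (V g + V w) by rewrite /d opprD addrA.
  by rewrite Vv addrA subrK.
have vf : rnorm (V v) <= mu * a^-1 * b^-1 * rnorm f.
  (* Testing against V v reproduces the equation satisfied by v, in which only
     the difference of the analysis operators survives. *)
  have e1 : rnorm (V v) ^+ 2 = rip (V v - U v) (U g).
    transitivity (rip (V v) (V g + V w - V h)); first by rewrite -Vv rip_sqr.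
    rewrite ripBr ripDr ripBl wE hE gE /d ripBr.
    by rewrite addrC [_ + (_ - _)]addrC subrK addrC.
  have vV : rnorm v <= b^-1 * rnorm (V v) by rewrite ler_pdivlMl.
  have [V0|V0] := eqVneq (rnorm (V v)) 0.
    by rewrite V0 !mulr_ge0 ?invr_ge0 ?rnorm_ge0 ?(ltW a0) ?(ltW b0).
  have Vp : 0 < rnorm (V v) by rewrite lt_neqAle eq_sym V0 rnorm_ge0.
  rewrite -(ler_pM2l Vp) -expr2 e1.
  apply: le_trans (ler_norm _) _; apply: le_trans (rip_le _ _) _.
  rewrite -rnormN opprB.
  apply: le_trans (ler_pM (rnorm_ge0 _) (rnorm_ge0 _) (close v) Pf) _.
  rewrite [leRHS](_ : _ = mu * (b^-1 * rnorm (V v)) * (a^-1 * rnorm f)).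
    rewrite ler_wpM2r ?mulr_ge0 ?invr_ge0 ?rnorm_ge0 ?(ltW a0)//.
    by rewrite ler_wpM2l.
  by ring.
have df : rnorm (d - V w) <= mu * a^-1 * a^-1 * rnorm f.
  apply: le_trans w_le _; apply: le_trans (close g) _.
  by rewrite -!mulrA ler_wpM2l.
by rewrite mulrDl; apply: le_trans (rnormD _ _) (lerD df vf).
Qed.

End DualPerturbation.
End Perturbation.

Theorem proposition4p4 (R : realType) (k : scalar_kind) (H : hilbertType R k)
    (separable_H : separable H) (Phi Psi : nat -> H) (m mu : R)
    (frame_Phi : is_frame_with_lower_bound Phi m)
    (perturbation_Psi : is_perturbation mu Phi Psi)
    (mu_lt : mu < Num.sqrt m) :
  is_frame_with_lower_bound Psi ((Num.sqrt m - mu) ^+ 2) /\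
  forall A : {linear H -> H}, continuous A ->
    opnorm (fun f : H => f - A f) < 1 ->
    [/\ is_bessel (canonical_dual Phi),
        is_bessel (canonical_approx_dual Psi A) &
        forall eps : R,
          is_approximation_rate Psi (canonical_approx_dual Psi A) eps ->
          frame_norm (canonical_dual Phi - canonical_approx_dual Psi A) <=
            (2 * mu * opnorm A + eps * Num.sqrt m) /
              (Num.sqrt m * (Num.sqrt m - mu))].
Proof.
have [hPhi a0 lowPhi] := frame_lower_bound_analysis frame_Phi.
have [hPsi hmu] := perturbation_Psi.
have mu0 : 0 <= mu := le_trans (opnorm_ge0 _) hmu.
move: a0 lowPhi mu_lt; set a := Num.sqrt m => a0 lowPhi mu_lt.
have b0 : 0 < a - mu by rewrite subr_gt0.
have [hD hDE] := bessel_sub hPhi hPsi.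
have close f : rnorm (analysis_op Phi f - analysis_op Psi f) <= mu * rnorm f.
  rewrite -hDE; apply: le_trans (rnorm_analysis_le_frame_norm hD f) _.
  by rewrite ler_wpM2r ?rnorm_ge0.
have lowPsi f : (a - mu) * rnorm f <= rnorm (analysis_op Psi f).
  rewrite mulrBl lerBlDr; apply: le_trans (lowPhi f) _.
  rewrite -(subrK (analysis_op Psi f) (analysis_op Phi f)) [leRHS]addrC.
  by apply: le_trans (rnormD _ _) _; rewrite lerD2r.
split; first exact: bessel_frame_lower_bound.
move=> A cA _.
have [C hC] := continuous_linear_le cA.
have hA := le_opnorm (linearZ_LR A) hC.
have [hd hdE] : is_bessel (canonical_dual Phi) /\
    forall f, analysis_op (canonical_dual Phi) f = dual_analysis Phi f.
  apply: bessel_of_bounded_map => [f n|f].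
    by rewrite -(inner_opinv hPhi a0 lowPhi) -bessel_analysisE.
  exact: (rnorm_dual_analysis_le hPhi a0 lowPhi f).
have [ha haE] : is_bessel (canonical_approx_dual Psi A) /\
    forall f, analysis_op (canonical_approx_dual Psi A) f = dual_analysis Psi (A f).
  apply: (@bessel_of_bounded_map _ _ _ _ _ ((a - mu)^-1 * opnorm A)) => [f n|f].
    rewrite -(adjointP hC) -(inner_opinv hPsi b0 lowPsi).
    by rewrite -bessel_analysisE.
  apply: le_trans (rnorm_dual_analysis_le hPsi b0 lowPsi (A f)) _.
  by rewrite -mulrA ler_wpM2l// invr_ge0 ltW.
split=> // eps [/andP[eps0 _] heps].
(* Synthesis by Psi of the approximate dual coefficients of f gives A f. *)
have hI f : rnorm (f - A f) <= eps * rnorm f.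
  have sc : scalable (fun f : H => f - A f).
    by move=> t x; rewrite linearZ_LR/= scalerBr.
  have bd x : rnorm (x - A x) <= (1 + C) * rnorm x.
    rewrite mulrDl mul1r; apply: le_trans (rnormD _ _) _.
    by rewrite rnormN lerD2l.
  apply: le_trans (le_opnorm sc bd f) _; rewrite ler_wpM2r ?rnorm_ge0//.
  move: heps; congr (opnorm _ <= _); apply/funext => x; congr (x - _).
  by rewrite haE [LHS](opinvK hPsi b0 lowPsi).
have [hs hsE] := bessel_sub hd ha.
apply: frame_norm_le => // [|f].
  by rewrite divr_ge0 ?addr_ge0 ?mulr_ge0 ?opnorm_ge0 ?(ltW a0) ?(ltW b0).
rewrite hsE hdE haE.
have -> : dual_analysis Phi f - dual_analysis Psi (A f) =
    (dual_analysis Phi (A f) - dual_analysis Psi (A f)) +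
    dual_analysis Phi (f - A f).
  by rewrite (dual_analysisB hPhi a0 lowPhi) [RHS]addrC addrA subrK.
have ab : a^-1 <= (a - mu)^-1 by rewrite lef_pV2 ?posrE// gerBl.
have n1 : rnorm (dual_analysis Phi (A f) - dual_analysis Psi (A f)) <=
    (2 * mu * a^-1 * (a - mu)^-1) * (opnorm A * rnorm f).
  have h := dual_analysis_perturbation hPhi hPsi a0 b0 mu0 lowPhi lowPsi close.
  apply: le_trans (h (A f)) _; apply: ler_pM; rewrite ?rnorm_ge0//.
    by rewrite addr_ge0 ?mulr_ge0 ?invr_ge0 ?(ltW a0) ?(ltW b0).
  rewrite -!mulrA mulr_natl mulr2n lerD2r ler_wpM2l// ler_wpM2l//.
  by rewrite invr_ge0 ltW.
have n2 : rnorm (dual_analysis Phi (f - A f)) <= (a - mu)^-1 * (eps * rnorm f).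
  apply: le_trans (rnorm_dual_analysis_le hPhi a0 lowPhi _) _.
  by apply: ler_pM; rewrite ?rnorm_ge0 ?invr_ge0 ?(ltW a0).
apply: le_trans (rnormD _ _) _; apply: le_trans (lerD n1 n2) _.
rewrite le_eqVlt; apply/orP; left; apply/eqP; field.
by rewrite !gt_eqF.
Qed.
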